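(* Let $f\in\mathbb{R}[x,y]$ be an irreducible polynomial and let $X=V(f)=\{(x,y)\in\mathbb{R}^2: f(x,y)=0\}$. Assume $X$ is compact and connected. Then $X$ has a cell decomposition $\mathcal{A}$ with the finiteness property.
   Context: A cell decomposition of a set $X\subseteq\mathbb{R}^2$ is a partition of $X$ into (finitely or countably many) cells, each of which is a semi-algebraic set: 0-cells are points, 1-cells are subsets homeomorphic to an open interval, 2-cells are subsets homeomorphic to an open disk. A shortest-length curve in $X$ between two points $A,B\in X$ is a piecewise $C^2$ curve $\gamma$ from $A$ to $B$ lying entirely in $X$ whose length is minimal among all piecewise $C^2$ curves in $X$ from $A$ to $B$. A geodesic line segment (relative to the decomposition) is either a straight line segment or a connected arc contained (partially or entirely) in a 1-cell. A cell decomposition $\mathcal{A}$ of $X$ has the finiteness property if for every shortest-length curve $\gamma$ in $X$ between two points of $X$ and every cell $e\in\mathcal{A}$, the set $\gamma\cap e$ is either empty or has finitely many connected components, each of which is either a singleton or a geodesic line segment. *)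

(* Defs.v *)
From HB Require Import structures.
From mathcomp Require Import all_boot all_order all_algebra.
From mathcomp Require Import all_classical all_reals all_analysis.

Set Implicit Arguments.
Unset Strict Implicit.
Unset Printing Implicit Defensive.

Import Order.TTheory GRing.Theory Num.Theory.
Import numFieldNormedType.Exports.
Local Open Scope classical_set_scope.
Local Open Scope ring_scope.


(* Bivariate real polynomials: polynomials in y with coefficients in R[x]. *)
Definition eval2 {R : realType} (f : {poly {poly R}}) (p : (R * R)) : R := (f.[p.2%:P]).[p.1].

Definition irreducible2 {R : realType} (f : {poly {poly R}}) : Prop :=
  f \isn't a GRing.unit /\
  forall g h : {poly {poly R}}, f = g * h -> g \is a GRing.unit \/ h \is a GRing.unit.

Definition zero_set {R : realType} (f : {poly {poly R}}) : set (R * R) := [set p | eval2 f p = 0].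

Inductive saformula (R : realType) :=
| SAzero of {poly {poly R}}
| SApos of {poly {poly R}}
| SAnot of saformula R
| SAand of saformula R & saformula R
| SAor of saformula R & saformula R.

Arguments SAzero {R}. Arguments SApos {R}. Arguments SAnot {R}. Arguments SAand {R}. Arguments SAor {R}.

Fixpoint sa_den {R : realType} (phi : saformula R) : set (R * R) :=
  match phi with
  | SAzero f => [set p | eval2 f p = 0]
  | SApos f => [set p | 0 < eval2 f p]
  | SAnot a => ~` sa_den a
  | SAand a b => sa_den a `&` sa_den b
  | SAor a b => sa_den a `|` sa_den b
  end.

Definition semialgebraic {R : realType} (S : set (R * R)) : Prop := exists phi : saformula R, S = sa_den phi.

Definition homeomorphic {T U : topologicalType} (A : set T) (B : set U) : Prop :=
  exists (f : T -> U) (g : U -> T),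
    [/\ f @` A `<=` B, g @` B `<=` A,
        (forall x, A x -> g (f x) = x) & (forall y, B y -> f (g y) = y)] /\
    {within A, continuous f} /\ {within B, continuous g}.

Definition open_unit_interval {R : realType} : set R := [set t | 0 < t < 1].
Definition open_unit_disk {R : realType} : set (R * R) := [set p | p.1 ^+ 2 + p.2 ^+ 2 < 1].

Definition is_0cell {R : realType} (e : set (R * R)) : Prop := exists p, e = [set p].
Definition is_1cell {R : realType} (e : set (R * R)) : Prop :=
  semialgebraic e /\ homeomorphic (@open_unit_interval R) e.
Definition is_2cell {R : realType} (e : set (R * R)) : Prop :=
  semialgebraic e /\ homeomorphic (@open_unit_disk R) e.
Definition is_cell {R : realType} (e : set (R * R)) : Prop := [\/ is_0cell e, is_1cell e | is_2cell e].

Definition cell_decomposition {R : realType} (X : set (R * R)) (A : set (set (R * R))) : Prop :=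
  [/\ countable A,
      (forall e, A e -> is_cell e),
      (forall e1 e2, A e1 -> A e2 -> e1 `&` e2 !=set0 -> e1 = e2) &
      \bigcup_(e in A) e = X].

Definition C2 {R : realType} (h : R -> R) : Prop :=
  [/\ (forall x, derivable h x 1), (forall x, derivable (derive1 h) x 1)
    & continuous (derive1 (derive1 h))].

Definition unit_interval {R : realType} : set R := [set t | 0 <= t <= 1].

Definition pw_C2 {R : realType} (gamma : R -> (R * R)) : Prop :=
  exists s : seq R,
    [/\ path <%R 0 s, last 0 s = 1 &
        forall i, (i < size s)%N ->
          exists g1 g2 : R -> R, [/\ C2 g1, C2 g2 &
            forall t, nth 0 (0 :: s) i <= t <= nth 0 s i -> gamma t = (g1 t, g2 t)]].

Definition curve_in {R : realType} (X : set (R * R)) (a b : (R * R)) (gamma : R -> (R * R)) : Prop :=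
  [/\ gamma 0 = a, gamma 1 = b & forall t, unit_interval t -> X (gamma t)].

Definition edist {R : realType} (p q : (R * R)) : R := Num.sqrt ((p.1 - q.1) ^+ 2 + (p.2 - q.2) ^+ 2).

Definition polygon_length {R : realType} (gamma : R -> (R * R)) (s : seq R) : R :=
  \sum_(i < (size s).-1) edist (gamma (nth 0 s i)) (gamma (nth 0 s i.+1)).

(* Length of a curve: supremum of inscribed polygon lengths (Jordan length);
   for piecewise C^2 curves this equals the integral of the speed. *)
Definition curve_length {R : realType} (gamma : R -> (R * R)) : \bar R :=
  ereal_sup [set x | exists s : seq R,
    [/\ sorted <=%R s, all (fun t => (0 <= t <= 1)) s & x = (polygon_length gamma s)%:E]].

Definition shortest_curve {R : realType} (X : set (R * R)) (a b : (R * R)) (gamma : R -> (R * R)) : Prop :=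
  [/\ pw_C2 gamma, curve_in X a b gamma &
      forall delta, pw_C2 delta -> curve_in X a b delta ->
        (curve_length gamma <= curve_length delta)%E].

Definition curve_image {R : realType} (gamma : R -> (R * R)) : set (R * R) := gamma @` (@unit_interval R).

Definition seg_point {R : realType} (p q : (R * R)) (t : R) : (R * R) :=
  ((1 - t) * p.1 + t * q.1, (1 - t) * p.2 + t * q.2).

(* A straight line segment (open, half-open or closed, nondegenerate). *)
Definition straight_segment {R : realType} (C : set (R * R)) : Prop :=
  exists p q : (R * R), [/\ p != q,
    seg_point p q @` (@open_unit_interval R) `<=` C &
    C `<=` seg_point p q @` (@unit_interval R)].

Definition real_interval {R : realType} (I : set R) : Prop :=
  (forall x y z, I x -> I z -> x <= y <= z -> I y) /\ exists x y, [/\ I x, I y & x < y].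
Definition arc {R : realType} (C : set (R * R)) : Prop :=
  exists I : set R, real_interval I /\ homeomorphic I C.

Definition geodesic_segment {R : realType} (A : set (set (R * R))) (C : set (R * R)) : Prop :=
  straight_segment C \/
  (arc C /\ exists e, [/\ A e, is_1cell e & C `<=` closure e]).

Definition finiteness_property {R : realType} (X : set (R * R)) (A : set (set (R * R))) : Prop :=
  forall (a b : (R * R)) (gamma : R -> (R * R)), shortest_curve X a b gamma ->
  forall e, A e ->
    let S := curve_image gamma `&` e in
    finite_set [set connected_component S x | x in S] /\
    forall x, S x ->
      is_0cell (connected_component S x) \/
      geodesic_segment A (connected_component S x).

(* Main.v *)
Require Import Defs.
From mathcomp Require Import all_boot all_order all_algebra.
From mathcomp Require Import all_classical all_reals all_analysis.
From mathcomp Require Import polyrcf lra zify.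
Import Order.TTheory GRing.Theory Num.Theory.
Import numFieldNormedType.Exports.

Set Implicit Arguments.
Unset Strict Implicit.
Unset Printing Implicit Defensive.
Local Open Scope classical_set_scope.
Local Open Scope ring_scope.

(* Away from finitely many abscissas, the zero set X of f is that of a polynomial q
   with nonvanishing y-derivative on X, so by Rolle, the intermediate value theorem
   and compactness, X splits above a small interval into finitely many disjoint
   graphs, each cut out of X by an open box and hence semialgebraic. The maximal
   dyadic intervals above which X splits miss only countably many abscissas, whose
   fibers are finite by compactness; countably many cells are allowed, so these
   graphs and the remaining points form a decomposition, and no quantifier
   elimination is needed.

   The finiteness property holds for every connected subset of X in place of a
   shortest curve: such a set can leave a graph cell, which is open in X, only
   through one of its two ends. *)

(** * Fibers and the squarefree part *)

Definition fiber (R : realType) (f : {poly {poly R}}) (x : R) : {poly R} :=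
  map_poly (horner_eval x) f.

Section Fibers.
Context {R : realType}.
Implicit Types (f g q : {poly {poly R}}) (x y : R).

Lemma eval2_fiber f x y : eval2 f (x, y) = (fiber f x).[y].
Proof.
rewrite /eval2 /fiber /=.
have -> : y = horner_eval x y%:P by rewrite /horner_eval hornerC.
by rewrite horner_map /horner_eval hornerC.
Qed.

Lemma fiberM f g x : fiber (f * g) x = fiber f x * fiber g x.
Proof. exact: rmorphM. Qed.

Lemma fiberD f g x : fiber (f + g) x = fiber f x + fiber g x.
Proof. exact: rmorphD. Qed.

Lemma fiberZ (c : {poly R}) f x : fiber (c *: f) x = c.[x] *: fiber f x.
Proof. by rewrite -!mul_polyC fiberM /fiber map_polyC. Qed.

Lemma deriv_fiber f x : (fiber f x)^`() = fiber f^`() x.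
Proof. exact: deriv_map. Qed.

Lemma fiber_eq0 f x : (lead_coef f).[x] != 0 -> fiber f x != 0.
Proof.
move=> lf; rewrite /fiber map_poly_eq0_id0 //.
by apply: contraNneq lf => ->; rewrite lead_coef0 horner0.
Qed.

(* The order of vanishing at a root of [G] drops by one from [G] to [G^`()], so
   [Q] has to make up for it. *)
Lemma root_cofactor_deriv (Q G K : {poly R}) y :
  G != 0 -> Q * G^`() = K * G -> root G y -> root Q y.
Proof.
move=> G0 QGK Gy.
have [m [H]] := multiplicity_XsubC G y; rewrite G0 /= => Hy GE.
case: m GE => [|m] GE; first by move: Gy; rewrite GE expr0 mulr1 (negPf Hy).
move: QGK; rewrite GE derivM deriv_exp derivXsubC mul1r /= => QGK.
have X0 : ('X - y%:P) ^+ m != 0 :> {poly R} by rewrite expf_neq0 ?polyXsubC_eq0.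
(* With ['X - y%:P] cancelled [m] times, evaluation at [y] leaves [(m+1) Q(y) H(y) = 0], where
   [H(y)] is nonzero. *)
have QHK : Q * (H^`() * ('X - y%:P) + H *+ m.+1) = K * H * ('X - y%:P).
  apply: (mulIf X0); rewrite -[RHS]mulrA -exprS -[RHS]mulrA -QGK -[LHS]mulrA.
  rewrite mulrDl; congr (_ * (_ + _)); first by rewrite exprS mulrA.
  by rewrite mulrnAl mulrnAr.
have := congr1 (fun p => p.[y]) QHK.
rewrite !hornerE hornerMn subrr !mulr0 add0r => /eqP.
by rewrite mulf_eq0 mulrn_eq0 /= => /orP[|Hy0] //; rewrite /root Hy0 in Hy.
Qed.

(** Induction on the degree in [y]. If [f] is coprime to its y-derivative, a Bezout relation gives a
    nonzero [c] in R[x] that vanishes at the abscissa of every common zero. Otherwise the gcd is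
    divided out, which loses no zeros outside finitely many abscissas. *)
Lemma squarefree_part f : f != 0 ->
  exists q (r : {poly R}), r != 0 /\ forall x, ~~ root r x -> forall y,
    (eval2 f (x, y) = 0 <-> eval2 q (x, y) = 0) /\
    (eval2 q (x, y) = 0 -> eval2 q^`() (x, y) != 0).
Proof.
have [n] := ubnP (size f); elim: n => // n IHn in f *; rewrite ltnS => fn f0.
have [cop|ncop] := boolP (coprimep f f^`()).
  have [[u v] /= /eqp_size] := Pdiv.Idomain.Bezoutp f f^`().
  rewrite (coprimep_size_gcd cop) => /eqP/size_poly1P[c c0 uvc].
  exists f, c; split=> // x cx y; split=> // fxy; apply: contra cx => /eqP f'xy.
  have := congr1 (fun h => (fiber h x).[y]) uvc.
  rewrite fiberD !fiberM hornerD !hornerM -!eval2_fiber fxy f'xy !mulr0 addr0.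
  by rewrite eval2_fiber /fiber map_polyC hornerC => /esym/eqP.
set g := gcdp f f^`() in ncop *.
have g0 : g != 0 by rewrite gcdp_eq0 (negPf f0).
(* Over R[x] the divisions by [g] hold only up to the nonzero scalars [c] and [d]. *)
have /Pdiv.Idomain.dvdpP[[c Q] /= c0 cf] := dvdp_gcdl f f^`().
have /Pdiv.Idomain.dvdpP[[d K] /= d0 df] := dvdp_gcdr f f^`().
rewrite -/g in cf df.
have Q0 : Q != 0.
  by apply: contra_neq f0 => Q0; apply/eqP;
    move/eqP: cf; rewrite Q0 mul0r -mul_polyC mulf_eq0 polyC_eq0 (negPf c0).
have sQ : (size Q < n)%N.
  apply: leq_trans fn; have := congr1 (fun h : {poly {poly R}} => size h) cf.
  rewrite size_scale // size_mul // => ->.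
  move: ncop; rewrite coprimep_def -/g; move: g0; rewrite -size_poly_gt0.
  by case: (size g) => [|[|k]] // _ _; rewrite addnS /= addnS ltnS leq_addr.
have [q [r [r0 qr]]] := IHn Q sQ Q0.
(* Off the roots of this product the values of [c] and [d] are invertible, the fiber of [g] is
   nonzero and the induction hypothesis for [Q] applies. *)
exists q, (c * d * lead_coef g * r); split.
  by rewrite !mulf_neq0 ?lead_coef_eq0.
move=> x; rewrite !rootM !negb_or => /andP[/andP[/andP[cx dx] gx] rx] y.
have [Qq qsimple] := qr x rx y; split=> //; rewrite -Qq.
have cfx : c.[x] *: fiber f x = fiber Q x * fiber g x by rewrite -fiberZ cf fiberM.
have dfx : d.[x] *: fiber f^`() x = fiber K x * fiber g x by rewrite -fiberZ df fiberM.
have fQg : (eval2 f (x, y) == 0) = (eval2 Q (x, y) == 0) || (eval2 g (x, y) == 0).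
  rewrite !eval2_fiber -mulf_eq0 -hornerM -cfx hornerZ mulf_eq0.
  by rewrite (negPf (_ : c.[x] != 0)).
split=> [/eqP|/eqP Qxy]; last by apply/eqP; rewrite fQg Qxy.
rewrite fQg => /orP[/eqP//|]; rewrite !eval2_fiber => gy.
have gx0 : fiber g x != 0 by apply: fiber_eq0.
(* Differentiating [c f = Q g] on the fiber and substituting [d f' = K g] gives
   [d Q g' = (c K - d Q') g], so a root of [g] is a root of [Q]. *)
have : root (d.[x] *: fiber Q x) y.
  apply: (@root_cofactor_deriv _ (fiber g x)
            (c.[x] *: fiber K x - d.[x] *: (fiber Q x)^`())) => //.
  have cfx' : c.[x] *: fiber f^`() x
      = (fiber Q x)^`() * fiber g x + fiber Q x * (fiber g x)^`().
    by rewrite -derivM -cfx derivZ deriv_fiber.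
  rewrite mulrBl -!scalerAl -dfx scalerA [_ * d.[x]]mulrC -scalerA cfx'.
  by rewrite scalerDr addrAC subrr add0r.
by rewrite rootZ // => /eqP.
Qed.

Lemma finite_roots (p : {poly R}) : p != 0 -> finite_set [set x | root p x].
Proof.
move=> p0; apply: (sub_finite_set _ (finite_seq (rootsR p))) => x /= px.
by have := roots_on_rootsR p0 x; rewrite px.
Qed.
End Fibers.

(** * Implicit functions *)

Section LocalGraph.
Context {R : realType}.
Implicit Types (f q : {poly {poly R}}) (x y : R).

Lemma continuous_eval2 f : continuous (eval2 f : R * R -> R).
Proof.
elim/poly_ind: f => [|f c IHf] p.
  have -> : eval2 (0 : {poly {poly R}}) = cst 0.
    by apply/funext => z; rewrite /eval2 !horner0.
  exact: cst_continuous.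
have -> : eval2 (f * 'X + c%:P) = fun z : R * R => eval2 f z * z.2 + c.[z.1].
  by apply/funext => z; rewrite /eval2 hornerMXaddC hornerD hornerM hornerC.
apply: cvgD; first by apply: cvgM; [exact: IHf | exact: cvg_snd].
by apply: continuous_comp; [exact: cvg_fst | exact: continuous_horner].
Qed.

Lemma cvg_pair_nbhs (T : Type) (F : set_system T) (FF : Filter F)
    (g h : T -> R) x y :
  g t @[t --> F] --> x -> h t @[t --> F] --> y ->
  (g t, h t) @[t --> F] --> (x, y).
Proof. by move=> gx hy; apply: (@cvg_pair _ _ _ F (nbhs x) (nbhs y)). Qed.

Lemma nbhs_pair_box (P : set (R * R)) x y : nbhs (x, y) P ->
  exists2 e, 0 < e & forall x' y', `|x' - x| < e -> `|y' - y| < e -> P (x', y').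
Proof.
move=> /nbhs_ballP[e /= e0 eP]; exists e => // x' y' xe ye.
by apply: eP; split; rewrite /ball /= distrC.
Qed.

(** Near [(x, y)] the y-derivative of [q] keeps its sign. Rolle's theorem then gives uniqueness of
    the root; a sign change between [y - e] and [y + e], stable in [x'], gives existence. Since
    every small [e] is allowed, the same statement yields both isolating boxes and continuity. *)
Lemma implicit_root q x y : eval2 q (x, y) = 0 -> eval2 q^`() (x, y) != 0 ->
  exists2 e0, 0 < e0 & forall e, 0 < e <= e0 -> exists2 d, 0 < d &
    forall x', `|x' - x| < d ->
      (exists2 z, `|z - y| < e & eval2 q (x', z) = 0) /\
      (forall z z', `|z - y| < e -> `|z' - y| < e ->
         eval2 q (x', z) = 0 -> eval2 q (x', z') = 0 -> z = z').
Proof.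
move=> qxy dqxy; set D := eval2 q^`() (x, y) in dqxy.
have : \forall p \near (x, y), 0 < D * eval2 q^`() p.
  have /(_ (x, y)) c : continuous (fun p : R * R => D * eval2 q^`() p).
    by move=> p; apply: cvgM; [exact: cvg_cst | exact: continuous_eval2].
  by apply: (cvgr_gt _ c); rewrite -expr2 exprn_even_gt0.
move=> /nbhs_pair_box[e1 e1_gt0 De1].
exists (e1 / 2); first lra.
move=> e /andP[e_gt0 ee1].
have uniq x' z z' : `|x' - x| < e1 -> `|z - y| < e1 -> `|z' - y| < e1 ->
    eval2 q (x', z) = 0 -> eval2 q (x', z') = 0 -> ~ z < z'.
  move=> xx' zy z'y; rewrite !eval2_fiber => qz qz' zz'.
  have [c] := poly_rolle zz' (etrans qz (esym qz')).
  rewrite in_itv /= => /andP[zc cz']; rewrite deriv_fiber -eval2_fiber => q'c.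
  have cy : `|c - y| < e1.
    by move: zy z'y; rewrite !ltr_norml => /andP[? ?] /andP[? ?]; apply/andP; split; lra.
  by have := De1 x' c xx' cy; rewrite q'c mulr0 ltxx.
(* By the mean value theorem the two values are [-e] and [e] times derivatives that both have the
   sign of [D]. *)
have sgn : eval2 q (x, y - e) * eval2 q (x, y + e) < 0.
  have [|c] := @poly_mvt _ y (y + e) (fiber q x); first lra.
  have [|c'] := @poly_mvt _ (y - e) y (fiber q x); first lra.
  rewrite !in_itv /= => /andP[c'1 c'2] + /andP[c1 c2].
  rewrite !deriv_fiber -!eval2_fiber qxy => q1 q2.
  have Dc : 0 < D * eval2 q^`() (x, c).
    by apply: De1; rewrite ?subrr ?normr0 // ltr_norml; apply/andP; split; lra.
  have Dc' : 0 < D * eval2 q^`() (x, c').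
    by apply: De1; rewrite ?subrr ?normr0 // ltr_norml; apply/andP; split; lra.
  have -> : eval2 q (x, y - e) = - (eval2 q^`() (x, c') * e) by lra.
  have -> : eval2 q (x, y + e) = eval2 q^`() (x, c) * e by lra.
  have cc' : 0 < eval2 q^`() (x, c') * eval2 q^`() (x, c).
    have : 0 < D ^+ 2 * (eval2 q^`() (x, c') * eval2 q^`() (x, c)).
      by rewrite expr2 mulrACA mulr_gt0.
    by rewrite pmulr_rgt0 // exprn_even_gt0.
  by rewrite mulNr oppr_lt0 mulrACA mulr_gt0 // mulr_gt0.
have : \forall x' \near x, eval2 q (x', y - e) * eval2 q (x', y + e) < 0.
  have c z : continuous (fun x' : R => eval2 q (x', z)).
    move=> x'; apply: (@continuous_comp _ _ _ (fun x' : R => (x', z)) (eval2 q)).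
      by apply: cvg_pair_nbhs; [exact: cvg_id | exact: cvg_cst].
    exact: continuous_eval2.
  have /(_ x) cc : continuous (fun x' : R => eval2 q (x', y - e) * eval2 q (x', y + e)).
    by move=> x'; apply: cvgM; exact: c.
  exact: (cvgr_lt _ cc).
move=> /nbhs_ballP[d1 /= d1_gt0 sgn_d1].
exists (Num.min d1 e1); first by rewrite lt_min d1_gt0.
move=> x'; rewrite lt_min => /andP[xd1 xe1]; split.
  have := sgn_d1 x'; rewrite /ball /= distrC => /(_ xd1).
  rewrite !eval2_fiber => s; have [|z] := poly_ivtoo _ s; first lra.
  rewrite in_itv /= => /andP[z1 z2] /rootP qz.
  by exists z; rewrite ?eval2_fiber // ltr_norml; apply/andP; split; lra.
move=> z z' zy z'y qz qz'; have [] := ltgtP z z' => //.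
  by move=> /(uniq x' z z' xe1) []; rewrite ?qz ?qz' //; lra.
by move=> /(uniq x' z' z xe1) []; rewrite ?qz ?qz' //; lra.
Qed.

End LocalGraph.

(** * Splitting above an interval *)

Definition strip (R : realType) (u v : R) : set (R * R) := [set p | u < p.1 < v].

(** Openness in [X] is what traps connected sets later. Semialgebraicity is a separate condition
    because [phi] is an arbitrary continuous function, with no formula for its graph. *)
Definition graph_cell (R : realType) (X : set (R * R)) (u v : R) (e : set (R * R)) :=
  [/\ semialgebraic e,
      exists2 O, open O & e = X `&` O &
      exists2 phi : R -> R, (forall x, u < x < v -> {for x, continuous phi}) &
        e = [set p | strip u v p /\ p.2 = phi p.1]].

Definition splits_over (R : realType) (X : set (R * R)) (u v : R) :=
  exists G : set (set (R * R)),
    [/\ countable G, (forall e, G e -> graph_cell X u v e),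
        (forall e1 e2, G e1 -> G e2 -> e1 `&` e2 !=set0 -> e1 = e2) &
        \bigcup_(e in G) e = X `&` strip u v].

Section Strips.
Context {R : realType}.
Implicit Types (f q : {poly {poly R}}) (x y u v : R) (X e : set (R * R)).

Lemma semialgebraicI e1 e2 :
  semialgebraic e1 -> semialgebraic e2 -> semialgebraic (e1 `&` e2).
Proof. by move=> [p1 ->] [p2 ->]; exists (SAand p1 p2). Qed.

Lemma semialgebraic_strip u v : semialgebraic (strip u v).
Proof.
exists (SAand (SApos ('X - u%:P)%:P) (SApos (v%:P - 'X)%:P)).
apply/seteqP; split=> p; rewrite /strip /= /eval2 !hornerE !subr_gt0.
  by move=> /andP.
by move=> [-> ->].
Qed.

Lemma semialgebraic_band y (r : R) : semialgebraic [set p : R * R | `|p.2 - y| < r].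
Proof.
exists (SAand (SApos ('X - (y - r)%:P%:P)) (SApos ((y + r)%:P%:P - 'X))).
apply/seteqP; split=> p; rewrite /= /eval2 !hornerE !subr_gt0 ltr_norml.
  by move=> /andP[? ?]; split; lra.
by move=> [? ?]; apply/andP; split; lra.
Qed.

Lemma semialgebraic_zero_set f : semialgebraic (zero_set f).
Proof. by exists (SAzero f). Qed.

Lemma open_strip u v : open (strip u v).
Proof.
have -> : strip u v = (fst : R * R -> R) @^-1` `]u, v[.
  by apply/seteqP; split=> p; rewrite /strip /= in_itv.
by apply: open_comp; [move=> p _; exact: cvg_fst | exact: itv_open].
Qed.

Lemma open_band y (r : R) : open [set p : R * R | `|p.2 - y| < r].
Proof.
have -> : [set p : R * R | `|p.2 - y| < r] = (snd : R * R -> R) @^-1` ball y r.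
  by apply/seteqP; split=> p; rewrite /ball /= distrC.
by apply: open_comp; [move=> p _; exact: cvg_snd | exact: ball_open].
Qed.

Lemma graph_cell_sub X u v u' v' e : u <= u' -> v' <= v ->
  graph_cell X u v e -> graph_cell X u' v' (e `&` strip u' v').
Proof.
move=> uu vv [sa [W oW eW] [phi cphi ephi]]; split.
- by apply: semialgebraicI => //; exact: semialgebraic_strip.
- by exists (W `&` strip u' v'); [apply: openI => //; exact: open_strip | rewrite eW setIA].
- exists phi; first by move=> x xuv; apply: cphi; lra.
  rewrite ephi; apply/seteqP; split=> p /=; rewrite /strip /=; first by case=> -[].
  by move=> [pu pe]; split=> //; split=> //; lra.
Qed.

(** Inheritance by subintervals is what allows the passage to dyadic intervals. *)
Lemma splits_over_sub X u v u' v' : u <= u' -> v' <= v ->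
  splits_over X u v -> splits_over X u' v'.
Proof.
move=> uu vv [G [cG gG dG UG]].
exists [set e `&` strip u' v' | e in G]; split.
- exact: sub_countable (card_image_le _ _) cG.
- by move=> _ [e Ge <-]; apply: graph_cell_sub (gG _ Ge).
- move=> _ _ [e1 Ge1 <-] [e2 Ge2 <-] [p [[e1p _] [e2p _] ] ].
  by rewrite (dG e1 e2) //; exists p.
- rewrite bigcup_image -setI_bigcupl UG -setIA; congr (_ `&` _).
  by apply/seteqP; split=> p; rewrite /strip /=; [case | move=> ?; split; lra].
Qed.

(** A zero fiber would put a whole vertical line into the zero set, which is bounded. *)
Lemma compact_fiber_neq0 f x : compact (zero_set f) -> fiber f x != 0.
Proof.
move=> cX; apply/eqP => fx0.
have : compact (snd @` zero_set f : set R).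
  by apply: continuous_compact => //; apply: continuous_subspaceT => p; exact: cvg_snd.
move=> /compact_bounded[M [_ bM]].
have M0 : 0 <= `|M| by [].
have MM : M < `|M| + 1 by have := ler_norm M; lra.
have : (snd @` zero_set f) (`|M| + 2).
  by exists (x, `|M| + 2) => //; rewrite /zero_set /= eval2_fiber fx0 horner0.
by move=> /(bM _ MM) /=; rewrite ger0_norm; lra.
Qed.

Lemma common_radius (s : seq R) (P : R -> R -> Prop) :
  (forall y, y \in s -> exists2 d : R, 0 < d & forall r : R, 0 < r <= d -> P y r) ->
  exists2 d : R, 0 < d & forall r : R, 0 < r <= d -> forall y, y \in s -> P y r.
Proof.
elim: s => [|a s IHs] Ps; first by exists 1.
have [d1 d10 P1] := Ps a (mem_head a s).
have [y ys|d2 d20 P2] := IHs; first by apply: Ps; rewrite in_cons ys orbT.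
exists (Num.min d1 d2); first by rewrite lt_min d10.
move=> r; rewrite le_min => /and3P[r0 r1 r2] y; rewrite in_cons => /predU1P[->|].
  by apply: P1; rewrite r0.
by apply: P2; rewrite r0.
Qed.


(** The unique root in the band defines [phi]. For continuity, [implicit_root] at a point of the
    graph finds a nearby root above each nearby abscissa, and uniqueness in the band identifies it
    with the value of [phi]. *)
Lemma strip_band_graph f q x y u v (r : R) : 0 < r ->
  (forall x', u < x' < v -> forall y',
     (eval2 f (x', y') = 0 <-> eval2 q (x', y') = 0) /\
     (eval2 q (x', y') = 0 -> eval2 q^`() (x', y') != 0)) ->
  (forall x', u < x' < v ->
     (exists2 z, `|z - y| < r & eval2 q (x', z) = 0) /\
     (forall z z', `|z - y| < r -> `|z' - y| < r ->
        eval2 q (x', z) = 0 -> eval2 q (x', z') = 0 -> z = z')) ->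
  graph_cell (zero_set f) u v
    (zero_set f `&` (strip u v `&` [set p | `|p.2 - y| < r])).
Proof.
move=> r0 fq uniq; split.
- apply: semialgebraicI; first exact: semialgebraic_zero_set.
  by apply: semialgebraicI; [exact: semialgebraic_strip | exact: semialgebraic_band].
- exists (strip u v `&` [set p | `|p.2 - y| < r]) => //.
  by apply: openI; [exact: open_strip | exact: open_band].
pose S t := [set z : R | `|z - y| < r /\ eval2 q (t, z) = 0].
(* The default 0 is never taken for [t] between [u] and [v], where [S t] is nonempty. *)
pose phi t := xget 0 (S t).
have phiP t : u < t < v -> `|phi t - y| < r /\ eval2 q (t, phi t) = 0.
  by move=> /uniq[[z zy qz] _]; apply: (@xgetPex _ 0 (S t)); exists z.
have phi_uniq t z : u < t < v -> `|z - y| < r -> eval2 q (t, z) = 0 -> z = phi t.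
  move=> tuv zy qz; have [_ uq] := uniq t tuv.
  by have [phiy qphi] := phiP t tuv; apply: uq.
exists phi; last first.
  apply/seteqP; split=> -[t z] /=.
    move=> [fz [tuv zy]]; split=> //; apply: phi_uniq => //.
    by apply: (proj1 (fq t tuv z).1).
  move=> [tuv ->]; have [phiy qphi] := phiP t tuv; split=> //.
  exact: (proj2 (fq t tuv _).1).
move=> t tuv; have [phiy qphi] := phiP t tuv.
have [d1 d1_gt0 imp] := implicit_root qphi ((fq t tuv _).2 qphi).
apply/cvgrPdist_lt => eps eps0.
(* The three bounds make [implicit_root] applicable, meet the tolerance [eps], and keep the nearby
   root inside the band. *)
pose d2 := Num.min d1 (Num.min eps (r - `|phi t - y|)).
have d2_gt0 : 0 < d2 by rewrite !lt_min d1_gt0 eps0 subr_gt0.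
have [|d d0 near_t] := imp d2; first by rewrite d2_gt0 /d2 ge_min lexx.
apply/nbhs_ballP; exists (Num.min d (Num.min (t - u) (v - t))) => /=.
  by rewrite !lt_min d0 !subr_gt0.
move=> t'; rewrite /ball /= distrC !lt_min => /and3P[td tu tv].
have t'uv : u < t' < v by move: tu tv; rewrite !ltr_norml => /andP[? ?] /andP[? ?]; lra.
have [[z]] := near_t t' td; rewrite !lt_min => /and3P[_ zeps zr] qz _.
rewrite -(phi_uniq t' z) //; first by rewrite distrC.
have := ler_normD (z - phi t) (phi t - y); rewrite addrA subrK; lra.
Qed.

Lemma finite_fiber f x : compact (zero_set f) ->
  exists s : seq R, forall y, (eval2 f (x, y) = 0) <-> (y \in s).
Proof.
move=> cX; have fx0 := compact_fiber_neq0 x cX.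
exists (rootsR (fiber f x)) => y.
have := roots_on_rootsR fx0 y; rewrite in_itv /= => <-.
by rewrite eval2_fiber; split=> /rootP.
Qed.

(** Each of the finitely many points above [x] gets a box in which the zero set is a graph; the
    boxes are disjoint, and by compactness they contain the whole zero set above a small interval
    around [x]. *)
Lemma splits_over_near f x : compact (zero_set f) ->
  forall q (r : {poly R}),
  (forall x', ~~ root r x' -> forall y',
     (eval2 f (x', y') = 0 <-> eval2 q (x', y') = 0) /\
     (eval2 q (x', y') = 0 -> eval2 q^`() (x', y') != 0)) ->
  ~~ root r x ->
  exists2 d, 0 < d & splits_over (zero_set f) (x - d) (x + d).
Proof.
move=> cX q r fq rx; have [s sP] := finite_fiber x cX.
have [d1 /= d1_gt0 rd1] : exists2 d : R, 0 < d & forall x', `|x' - x| < d -> ~~ root r x'.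
  (* Squaring turns the nonvanishing of [r] into a strict inequality, which persists near [x]. *)
  have r2x : 0 < (r ^+ 2).[x] by rewrite horner_exp exprn_even_gt0.
  have : \forall x' \near x, 0 < (r ^+ 2).[x'].
    exact: (cvgr_gt _ (@continuous_horner _ (r ^+ 2) x)).
  move=> /nbhs_ballP[d /= d0 rd]; exists d => // x' xx'; apply/negP => /rootP rx'.
  by have := rd x'; rewrite /ball /= distrC horner_exp rx' expr0n ltxx => /(_ xx').
pose good_box y (a : R) := exists2 d, 0 < d & forall x', `|x' - x| < d ->
  (exists2 z, `|z - y| < a & eval2 q (x', z) = 0) /\
  (forall z z', `|z - y| < a -> `|z' - y| < a ->
     eval2 q (x', z) = 0 -> eval2 q (x', z') = 0 -> z = z').
have [a a_gt0 aP] : exists2 a, 0 < a &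
    forall b, 0 < b <= a -> forall y, y \in s -> good_box y b.
  apply: common_radius => y /sP fxy.
  have [/proj1 /(_ fxy) qxy dq] := fq x rx y.
  by have [a a0 aP] := implicit_root qxy (dq qxy); exists a.
(* Uniqueness in a box of radius [a] separates the roots by at least [a], so the bands of radius
   [a / 2] are disjoint. *)
have sep y y' : y \in s -> y' \in s -> `|y - y'| < a -> y = y'.
  move=> ys y's yy'; have [|d d0 /(_ x)] := aP a _ y' y's; first by rewrite a_gt0 lexx.
  rewrite subrr normr0 => /(_ d0)[_ uniq].
  apply: uniq => //; rewrite ?subrr ?normr0 //.
    by apply/(proj1 (fq x rx y).1)/sP.
  by apply/(proj1 (fq x rx y').1)/sP.
have [d2 d2_gt0 d2P] : exists2 d, 0 < d & forall d', 0 < d' <= d ->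
    forall y, y \in s -> forall x', `|x' - x| < d' ->
      (exists2 z, `|z - y| < a / 2 & eval2 q (x', z) = 0) /\
      (forall z z', `|z - y| < a / 2 -> `|z' - y| < a / 2 ->
         eval2 q (x', z) = 0 -> eval2 q (x', z') = 0 -> z = z').
  apply: common_radius => y ys.
  have [|d d0 dP] := aP (a / 2) _ y ys; first lra.
  by exists d => // d' /andP[_ d'd] x' x'd'; apply: dP; apply: lt_le_trans d'd.
have [d3 /= d3_gt0 d3P] : exists2 d : R, 0 < d & forall p, zero_set f p -> `|p.1 - x| < d ->
    exists2 y, y \in s & `|p.2 - y| < a / 2.
  (* [K] is the part of the zero set outside all bands. Its projection is compact, hence closed, and
     misses [x]. *)
  pose K := zero_set f `&` [set p | forall y, y \in s -> a / 2 <= `|p.2 - y|].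
  have cK : compact (fst @` K).
    apply: continuous_compact; first by apply: continuous_subspaceT => p; exact: cvg_fst.
    apply: compact_closedI => //.
    have -> : [set p : R * R | forall y, y \in s -> a / 2 <= `|p.2 - y|]
        = \bigcap_(y in [set` s]) ~` [set p | `|p.2 - y| < a / 2].
      apply/seteqP; split=> p /= h y ys; first by apply/negP; rewrite -leNgt h.
      by rewrite leNgt; apply/negP/h.
    by apply: closed_bigI => y _; apply: open_closedC; exact: open_band.
  have : open (~` (fst @` K)).
    by apply: closed_openC; apply: compact_closed cK; exact: norm_hausdorff.
  rewrite openE => /(_ x)[[[x' y]/= [fp yfar] xx']|].
    move: fp yfar; rewrite xx' => /sP ys /(_ _ ys).
    by rewrite subrr normr0; lra.
  move=> d /= d0 dK; exists d => // p fp pd; apply: contrapT => far.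
  apply: (dK p.1); first by rewrite /ball /= distrC.
  exists p => //; split=> // y ys; rewrite leNgt; apply/negP => yp.
  by apply: far; exists y.
pose d := Num.min d1 (Num.min d2 d3).
have d_gt0 : 0 < d by rewrite !lt_min d1_gt0 d2_gt0.
have stripE x' : x - d < x' < x + d -> `|x' - x| < d.
  by move=> ?; rewrite ltr_norml; lra.
exists d => //.
exists [set zero_set f `&` (strip (x - d) (x + d) `&` [set p | `|p.2 - y| < a / 2])
       | y in [set` s]]; split.
- by apply: finite_set_countable; apply: finite_image; exact: finite_seq.
- move=> _ [y /= ys <-]; apply: (@strip_band_graph f q x); first lra.
    by move=> x' /stripE x'd; apply/fq/rd1; apply: lt_le_trans x'd _; rewrite ge_min lexx.
  move=> x' /stripE x'd; apply: (d2P d) => //.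
  by rewrite d_gt0 /d !ge_min lexx orbT.
- move=> _ _ [y /= ys <-] [y' /= y's <-] [p [[_ [_ /= py]] [_ [_ /= py']]]].
  suff -> : y = y' by [].
  apply: sep => //; rewrite -(subrK p.2 y) -addrA.
  by apply: le_lt_trans (ler_normD _ _) _; rewrite [`|y - _|]distrC; lra.
- apply/seteqP; split=> p; first by case=> _ [y /= ys <-] [fp [pd _]].
  move=> [fp pd]; have [|y ys py] := d3P p fp.
    by apply: lt_le_trans (stripE _ pd) _; rewrite !ge_min lexx !orbT.
  by exists (zero_set f `&` (strip (x - d) (x + d) `&` [set p | `|p.2 - y| < a / 2]));
    [exists y | split].
Qed.

End Strips.

(** * Maximal dyadic intervals *)

Section Dyadic.
Context {R : realType}.

Lemma countableU (T : Type) (A B : set T) :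
  countable A -> countable B -> countable (A `|` B).
Proof.
move=> cA cB; have -> : A `|` B = \bigcup_(b in [set: bool]) (if b then A else B).
  apply/seteqP; split=> x; first by case=> ?; [exists true | exists false].
  by case=> -[] _ ?; [left | right].
by apply: bigcup_countable => // -[].
Qed.

(** The form without division reduces comparisons of intervals to comparisons of integers. *)
Let in_dyadic (n : nat) (k : int) (x : R) := k%:~R < x * 2 ^+ n < (k + 1)%:~R.

Let dyadic (n : nat) (k : int) : R * R := (k%:~R / 2 ^+ n, (k + 1)%:~R / 2 ^+ n).

Let in_dyadicE n k x : ((dyadic n k).1 < x < (dyadic n k).2) = in_dyadic n k x.
Proof. by rewrite /dyadic /in_dyadic /= ltr_pdivrMr ?exprn_gt0 // ltr_pdivlMr ?exprn_gt0. Qed.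

Let in_dyadic_uniq n k l x : in_dyadic n k x -> in_dyadic n l x -> k = l.
Proof.
move=> /andP[k1 k2] /andP[l1 l2].
have := lt_trans k1 l2; have := lt_trans l1 k2; rewrite !ltr_int; lia.
Qed.

(** At the finer scale the coarse interval has integer end points, and no integer lies strictly
    between [k] and [k + 1]. *)
Let in_dyadic_nested m n k l x y : (m <= n)%N ->
  in_dyadic n k x -> in_dyadic m l x -> in_dyadic n k y -> in_dyadic m l y.
Proof.
move=> mn /andP[kx xk] mlx /andP[ky yk].
have c0 : 0 < (2 ^+ (n - m) : R) by rewrite exprn_gt0.
have E z : z * 2 ^+ n = z * 2 ^+ m * 2 ^+ (n - m) :> R by rewrite -mulrA -exprD subnKC.
have C : (2 ^+ (n - m) : R) = (2 ^+ (n - m) : int)%:~R by rewrite rmorphXn.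
have refine z : in_dyadic m l z =
    ((l * 2 ^+ (n - m))%:~R < z * 2 ^+ n < ((l + 1) * 2 ^+ (n - m))%:~R).
  by rewrite E !intrM -C !ltr_pM2r.
move: mlx; rewrite !refine => /andP[lx xl].
apply/andP; split.
  apply: le_lt_trans ky; rewrite ler_int -ltzD1 -(ltr_int R); exact: lt_trans xk.
apply: lt_le_trans yk _; rewrite ler_int lezD1 -(ltr_int R); exact: lt_trans xl.
Qed.

(* The chosen intervals are the maximal dyadic intervals on which [P] holds. *)
Lemma dyadic_partition (P : R -> R -> Prop) (D : set R) :
  (forall u v u' v', u <= u' -> v' <= v -> P u v -> P u' v') ->
  (forall x, ~ D x -> exists2 d, 0 < d & P (x - d) (x + d)) ->
  exists T : set (R * R),
    [/\ countable T, forall I, T I -> I.1 < I.2 /\ P I.1 I.2,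
        forall I J, T I -> T J ->
          (exists x, I.1 < x < I.2 /\ J.1 < x < J.2) -> I = J &
        countable ([set x | forall I, T I -> ~ I.1 < x < I.2] `\` D)].
Proof.
move=> Psub Pnear.
pose maximal n k := P (dyadic n k).1 (dyadic n k).2 /\
  forall m l x, (m < n)%N -> P (dyadic m l).1 (dyadic m l).2 ->
    in_dyadic n k x -> ~ in_dyadic m l x.
exists [set dyadic nk.1 nk.2 | nk in [set nk | maximal nk.1 nk.2]]; split.
- exact: sub_countable (card_image_le _ _) (countableP _).
- move=> _ [[n k] [Pnk _] <-]; split=> //=.
  by rewrite ltr_pM2r ?invr_gt0 ?exprn_gt0 // ltr_int ltzD1.
- move=> _ _ [[n k] [/= Pnk maxn] <-] [[m l] [/= Pml maxm] <-] [x].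
  rewrite !in_dyadicE => -[xn xm]; have [mn|nm|nm] := ltngtP m n.
  + by have := maxn _ _ _ mn Pml xn xm.
  + by have := maxm _ _ _ nm Pnk xm xn.
  + by rewrite nm in xm *; rewrite (in_dyadic_uniq xn xm).
(* Every uncovered point outside [D] is a dyadic rational: any other point lies in an open dyadic
   interval at each level, and the first level at which [P] holds gives a maximal one. *)
have sub : [set x | forall I, [set dyadic nk.1 nk.2 | nk in [set nk | maximal nk.1 nk.2]] I ->
    ~ I.1 < x < I.2] `\` D `<=` [set nk.2%:~R / 2 ^+ nk.1 | nk in [set: nat * int]].
  move=> x [/= xT Dx]; apply: contrapT => xnd.
  have floor_in n : in_dyadic n (Num.floor (x * 2 ^+ n)) x.
    rewrite /in_dyadic; have /andP[fl ->] := floor_itv (x * 2 ^+ n); rewrite andbT lt_neqAle fl andbT.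
    apply/eqP => xE; apply: xnd; exists (n, Num.floor (x * 2 ^+ n)) => //=.
    by rewrite xE mulfK // expf_neq0.
  pose Q n := `[< P (dyadic n (Num.floor (x * 2 ^+ n))).1
                    (dyadic n (Num.floor (x * 2 ^+ n))).2 >].
  have exQ : exists n, Q n.
    have [d d0 Pd] := Pnear x Dx.
    have dV : 0 <= d^-1 by rewrite invr_ge0 ltW.
    (* Since [2 ^+ n] exceeds [d^-1], the level [n] interval around [x] is shorter than [d] and
       stays within distance [d] of [x]. *)
    set n := Num.bound d^-1.
    have dn : 1 < d * 2 ^+ n.
      rewrite -[ltLHS](mulfV (lt0r_neq0 d0)) ltr_pM2l //; apply: lt_le_trans (archi_boundP dV) _.
      by rewrite -natrX ler_nat ltnW // ltn_expl.
    exists n; apply/asboolP; apply: Psub Pd; have /andP[] := floor_in n.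
      rewrite /= ler_pdivlMr ?exprn_gt0 // intrD; lra.
    rewrite /= ler_pdivrMr ?exprn_gt0 // intrD; lra.
  have [n /asboolP Pn nmin] := ex_minnP exQ.
  apply: (xT (dyadic n (Num.floor (x * 2 ^+ n)))).
    exists (n, Num.floor (x * 2 ^+ n)) => //; split=> //= m l z mn Pml zn zm.
    have xm := in_dyadic_nested (ltnW mn) zn zm (floor_in n).
    rewrite (in_dyadic_uniq xm (floor_in m)) in Pml.
    by have := nmin m (asboolT Pml); rewrite leqNgt mn.
  by rewrite in_dyadicE floor_in.
apply: (sub_countable (subset_card_le sub)).
exact: sub_countable (card_image_le _ _) (countableP _).
Qed.

End Dyadic.

(** * Connected sets and graph cells *)

Section Components.
Context {R : realType}.
Implicit Types (X e Gam C : set (R * R)) (u v : R).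

Lemma continuous_graph u v (phi : R -> R) :
  (forall x, u < x < v -> {for x, continuous phi}) ->
  forall x, u < x < v -> {for x, continuous (fun z => (z, phi z))}.
Proof. by move=> cphi x xuv; apply: cvg_pair_nbhs; [exact: cvg_id | exact: cphi]. Qed.

Lemma within_continuous_graph u v (phi : R -> R) (I : set R) :
  (forall x, u < x < v -> {for x, continuous phi}) ->
  (forall x, I x -> u < x < v) ->
  {within I, continuous (fun z => (z, phi z))}.
Proof.
move=> cphi Iuv; apply: continuous_in_subspaceT => x /set_mem Ix.
exact: continuous_graph (Iuv _ Ix).
Qed.

(** The arc of the graph between [p] and [q] is a connected subset of [S] containing both. *)
Lemma connected_component_graph u v (phi : R -> R) (S : set (R * R)) p q :
  (forall x, u < x < v -> {for x, continuous phi}) ->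
  S `<=` [set p | strip u v p /\ p.2 = phi p.1] ->
  S p -> S q -> (forall z, p.1 <= z <= q.1 \/ q.1 <= z <= p.1 -> S (z, phi z)) ->
  connected_component S p = connected_component S q.
Proof.
move=> cphi Sphi.
wlog pq : p q / p.1 <= q.1.
  move=> wl Sp Sq Spq; have [|] := leP p.1 q.1; first by move=> ?; apply: wl.
  by move=> /ltW ?; apply/esym/wl => // z [?|?]; apply: Spq; [right | left].
move=> Sp Sq Spq; apply: same_connected_component.
have pE : (p.1, phi p.1) = p by have [_ <-] := Sphi _ Sp; case: (p).
have qE : (q.1, phi q.1) = q by have [_ <-] := Sphi _ Sq; case: (q).
have arcS : (fun z => (z, phi z)) @` `[p.1, q.1] `<=` S.
  by move=> _ [z /=+ <-]; rewrite in_itv /= => zpq; apply: Spq; left.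
apply: (connected_component_max _ arcS); last by exists q.1 => //=; rewrite in_itv /= pq lexx.
  by exists p.1 => //=; rewrite in_itv /= pq lexx.
apply: connected_continuous_connected; first exact: segment_connected.
apply: (within_continuous_graph cphi) => z /=; rewrite in_itv /= => zpq.
by have [] := Sphi _ (Spq z (or_introl zpq)).
Qed.

(* A connected set that meets a graph cell but avoids it above [z1] and [z2] is
   trapped between them: the trapped part is clopen. *)
Lemma connected_trapped X u v e (phi : R -> R) Gam p z1 z2 :
  (exists2 W, open W & e = X `&` W) ->
  (forall x, u < x < v -> {for x, continuous phi}) ->
  e = [set p | strip u v p /\ p.2 = phi p.1] ->
  Gam `<=` X -> connected Gam -> Gam p -> e p ->
  u < z1 -> z1 < p.1 -> p.1 < z2 -> z2 < v ->
  ~ Gam (z1, phi z1) -> ~ Gam (z2, phi z2) ->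
  Gam `<=` strip z1 z2.
Proof.
move=> [W oW eW] cphi ephi GX cG Gp ep uz1 z1p pz2 z2v Gz1 Gz2.
suff <- : Gam `&` e `&` strip z1 z2 = Gam by move=> q [].
apply: cG.
- by exists p; split=> //; rewrite /strip /= z1p.
- exists (W `&` strip z1 z2); first by apply: openI => //; exact: open_strip.
  rewrite eW !setIA; congr (_ `&` _ `&` _).
  by apply/seteqP; split=> q; [case | move=> Gq; split=> //; exact: GX].
(* For closedness: [Gam] misses both end points of this compact arc, so the open strip cuts the same
   part out of [Gam]. *)
- exists ((fun z => (z, phi z)) @` `[z1, z2]).
    apply: compact_closed; first exact: norm_hausdorff.
    apply: continuous_compact; last exact: segment_compact.
    by apply: (within_continuous_graph cphi) => z /=; rewrite in_itv /=; lra.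
  rewrite ephi; apply/seteqP; split=> -[x y] /=.
    move=> [[Gxy [xuv yE]] xz]; subst y; split=> //; exists x => //.
    by move: xz; rewrite in_itv /strip /=; lra.
  move=> [Gxy [z zin [zx zy]]]; subst x y; move: zin; rewrite in_itv /= => /andP[z1z zz2].
  have zz1 : z1 != z by apply/eqP => zz; apply: Gz1; rewrite zz.
  have zz2' : z != z2 by apply/eqP => zz; apply: Gz2; rewrite -zz.
  have z1z' : z1 < z by rewrite lt_neqAle zz1.
  have zz2'' : z < z2 by rewrite lt_neqAle zz2'.
  by split; [split=> //; split=> //; rewrite /strip /=; lra | rewrite /strip /=; lra].
Qed.

Lemma finite_image_subsingleton (T U : Type) (h : T -> U) (A : set T) :
  (forall x y, A x -> A y -> h x = h y) -> finite_set (h @` A).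
Proof.
move=> hA; have [[x Ax]|A0] := pselect (exists x, A x).
  by apply: (sub_finite_set _ (finite_set1 (h x))) => z [y Ay <-] /=; exact: hA.
by apply: (sub_finite_set _ (finite_set0 U)) => z [y Ay _]; apply: A0; exists y.
Qed.

(* Each component of [Gam `&` e] reaches the left end of [e], or its right end, or
   the fiber of a fixed base point of [Gam]. *)
Lemma finite_components X u v e Gam :
  graph_cell X u v e -> Gam `<=` X -> connected Gam ->
  finite_set [set connected_component (Gam `&` e) x | x in Gam `&` e].
Proof.
move=> [_ We [phi cphi ephi]] GX cG.
have [[c Gc]|G0] := pselect (exists c, Gam c); last first.
  have -> : Gam `&` e = set0 by apply/seteqP; split=> // p [Gp _]; apply: G0; exists p.
  by rewrite image_set0; exact: finite_set0.
set S := Gam `&` e.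
have Sphi : S `<=` [set p | strip u v p /\ p.2 = phi p.1] by rewrite -ephi => p [].
pose L := [set p | S p /\ forall z, u < z <= p.1 -> S (z, phi z)].
pose L' := [set p | S p /\ forall z, p.1 <= z < v -> S (z, phi z)].
pose M := [set p | S p /\
  forall z, c.1 <= z <= p.1 \/ p.1 <= z <= c.1 -> S (z, phi z)].
(* A point in none of the three sets has missing abscissas [z1] to its left, [z2] to its right, and
   [z3] between it and the base point [c]. *)
have SE : S = L `|` L' `|` M.
  apply/seteqP; split=> p; last by case=> [[]|] [].
  move=> Sp; apply: contrapT => nLM.
  have pE : (p.1, phi p.1) = p by have [_ <-] := Sphi _ Sp; case: (p).
  have puv : u < p.1 < v by have [] := Sphi _ Sp.
  have Sn z : ~ S (z, phi z) -> z != p.1.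
    by move=> nS; apply/eqP => zp; apply: nS; rewrite zp pE.
  have Gn z : u < z < v -> ~ S (z, phi z) -> ~ Gam (z, phi z).
    by move=> zuv nS Gz; apply: nS; split=> //; rewrite ephi.
  have [z1 z1u nS1] : exists2 z, u < z < p.1 & ~ S (z, phi z).
    apply: contrapT => h; apply: nLM; left; left; split=> // z /andP[uz zp].
    apply: contrapT => nS; apply: h; exists z => //.
    by rewrite uz lt_neqAle zp Sn.
  have [z2 z2v nS2] : exists2 z, p.1 < z < v & ~ S (z, phi z).
    apply: contrapT => h; apply: nLM; left; right; split=> // z /andP[pz zv].
    apply: contrapT => nS; apply: h; exists z => //.
    by rewrite zv andbT lt_neqAle pz eq_sym Sn.
  have [z3 z3c nS3] : exists2 z, c.1 <= z < p.1 \/ p.1 < z <= c.1 & ~ S (z, phi z).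
    apply: contrapT => h; apply: nLM; right; split=> // z zc.
    apply: contrapT => nS; apply: h; exists z => //; have := Sn z nS.
    by case: zc => /andP[a b] zp; [left | right]; rewrite ?a ?b ?andbT lt_neqAle ?a ?b ?zp // eq_sym zp.
  have [Gp ep] := Sp.
  have trap a b : u < a -> a < p.1 -> p.1 < b -> b < v ->
      ~ S (a, phi a) -> ~ S (b, phi b) -> a < c.1 < b.
    move=> ua ap pb bv Sa Sb.
    apply: (connected_trapped We cphi ephi GX cG Gp ep ua ap pb bv) => //.
      by apply: Gn => //; lra.
    by apply: Gn => //; lra.
  (* Trapping between the missing abscissas nearest to [p] on each side forces [c] between them,
     although [z3] separates it from [p]. *)
  case: z3c => /andP[z3l z3r].
    have [z13|z31] := leP z1 z3.
      by have := trap z3 z2; move=> /(_ _ _ _ _ nS3 nS2); lra.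
    by have := trap z1 z2; move=> /(_ _ _ _ _ nS1 nS2); lra.
  have [z32|z23] := leP z3 z2.
    by have := trap z1 z3; move=> /(_ _ _ _ _ nS1 nS3); lra.
  by have := trap z1 z2; move=> /(_ _ _ _ _ nS1 nS2); lra.
(* Two points of the same set are joined by an arc inside [S], so each set meets at most one
   component. *)
rewrite [X in image X _]SE !image_setU !finite_setU; split; first split.
- apply: finite_image_subsingleton => p q [Sp pL] [Sq qL].
  have [/andP[up _] _] := Sphi _ Sp; have [/andP[uq _] _] := Sphi _ Sq.
  apply: (connected_component_graph cphi Sphi) => // z [z12|z12].
    by apply: qL; lra.
  by apply: pL; lra.
- apply: finite_image_subsingleton => p q [Sp pL] [Sq qL].
  have [/andP[_ pv] _] := Sphi _ Sp; have [/andP[_ qv] _] := Sphi _ Sq.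
  apply: (connected_component_graph cphi Sphi) => // z [z12|z12].
    by apply: pL; lra.
  by apply: qL; lra.
- apply: finite_image_subsingleton => p q [Sp pM] [Sq qM].
  apply: (connected_component_graph cphi Sphi) => // z z12.
  have [zc|cz] := leP z c.1; case: z12 => /andP[z1 z2].
  + by apply: pM; right; rewrite z1.
  + by apply: qM; right; rewrite z1.
  + by apply: qM; left; rewrite z2 ltW.
  + by apply: pM; left; rewrite z2 ltW.
Qed.

(** * Graph cells as arcs and 1-cells *)

(** The first projection is a homeomorphism from [C] onto an interval, with the graph map as
    inverse; the interval is nondegenerate once [C] has two points. *)
Lemma connected_subset_graph X u v e C : graph_cell X u v e ->
  connected C -> C !=set0 -> C `<=` e -> is_0cell C \/ Defs.arc C.
Proof.
move=> [_ _ [phi cphi ephi]] cC [p Cp] Ce.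
have CE q : C q -> strip u v q /\ q = (q.1, phi q.1).
  by move=> /Ce; rewrite ephi => -[? <-]; split=> //; case: (q).
have [[q Cq qp]|onlyp] := pselect (exists2 q, C q & q != p); last first.
  left; exists p; apply/seteqP; split=> [q Cq|q -> //].
  by apply: contrapT => qp; apply: onlyp; exists q => //; apply/eqP.
right; exists (fst @` C); split; first split.
- have : connected (fst @` C).
    apply: connected_continuous_connected => //.
    by apply: continuous_subspaceT => z; exact: cvg_fst.
  move=> /connected_intervalP Iint x y z Ix Iz xyz; exact: Iint Ix Iz _ xyz.
- have : q.1 != p.1.
    by apply: contra_neq qp => qp1; rewrite (CE q Cq).2 (CE p Cp).2 /= qp1.
  by rewrite neq_lt => /orP[lt|lt]; [exists q.1, p.1 | exists p.1, q.1]; split=> //;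
    by [exists q | exists p].
exists (fun z => (z, phi z)), fst; split; [split|split] => //.
- by move=> _ [_ [z Cz <-] <-]; rewrite -(CE z Cz).2.
- by move=> z Cz; exact/esym/(CE z Cz).2.
- by apply: (within_continuous_graph cphi) => _ [z Cz <-]; have [] := CE z Cz.
- by apply: continuous_subspaceT => z; exact: cvg_fst.
Qed.

Lemma is_1cell_graph_cell X u v e : u < v -> graph_cell X u v e -> is_1cell e.
Proof.
move=> uv [sa _ [phi cphi ephi]]; split=> //.
have vu : v - u != 0 by rewrite subr_eq0 gt_eqF.
have in_uv t : open_unit_interval t -> u < u + (v - u) * t < v.
  rewrite /open_unit_interval /= => /andP[t0 t1]; have : 0 < v - u by lra.
  move=> vu0; have : 0 < (v - u) * t by rewrite mulr_gt0.
  have : (v - u) * t < (v - u) * 1 by rewrite ltr_pM2l.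
  by rewrite mulr1 => ? ?; apply/andP; split; lra.
exists (fun t => (u + (v - u) * t, phi (u + (v - u) * t))), (fun p => (p.1 - u) / (v - u)).
split; [split|split].
- by move=> _ [t /in_uv tuv <-]; rewrite ephi.
- move=> _ [p + <-]; rewrite ephi => -[/andP[up pv] _]; rewrite /open_unit_interval /=.
  have vu0 : 0 < v - u by lra.
  by rewrite divr_gt0 ?ltr_pdivrMr ?mul1r //; lra.
- by move=> t _ /=; rewrite addrC addKr mulrC mulKf.
- move=> p; rewrite ephi => -[_ pphi].
  by rewrite mulrC divfK // subrKC -pphi; case: (p).
- apply: continuous_in_subspaceT => t /set_mem /in_uv tuv.
  apply: (@continuous_comp _ _ _ (fun t => u + (v - u) * t) (fun z => (z, phi z))).
    by apply: cvgD; [exact: cvg_cst | apply: cvgM; [exact: cvg_cst | exact: cvg_id]].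
  exact: continuous_graph tuv.
- apply: continuous_subspaceT => p; apply: cvgM; last exact: cvg_cst.
  by apply: cvgB; [exact: cvg_fst | exact: cvg_cst].
Qed.

(** * Connectedness of curve images *)

Lemma C2_continuous (h : R -> R) : C2 h -> continuous h.
Proof.
by move=> [dh _ _] x; apply: differentiable_continuous; apply/derivable1_diffP.
Qed.

(** Consecutive pieces share the image of their common breakpoint. *)
Lemma connected_chain (gam : R -> R * R) (s : seq R) a : path <%R a s ->
  (forall i, (i < size s)%N ->
     connected (gam @` `[nth 0 (a :: s) i, nth 0 s i]%classic)) ->
  connected (gam @` `[a, last a s]%classic).
Proof.
elim: s a => [a _ _|b s IHs a] /=; first by rewrite set_itv1 image_set1; exact: connected1.
move=> /andP[ab bs] cs.
have bl : b <= last b s.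
  elim: s b bs {IHs cs ab} => //= c s IHs b /andP[bc cs].
  exact: le_trans (ltW bc) (IHs _ cs).
have -> : `[a, last b s]%classic = `[a, b]%classic `|` `[b, last b s]%classic.
  apply/seteqP; split=> t; rewrite /= !in_itv /=.
    by move=> /andP[at_ tl]; have [tb|bt] := leP t b; [left; rewrite at_ | right; rewrite ltW].
  by case=> /andP[? ?]; apply/andP; split; lra.
rewrite image_setU; apply: connectedU; last by apply: IHs => // i; exact: (cs i.+1).
  exists (gam b); split; exists b => //; rewrite /= in_itv /= ?lexx ?bl //.
  by rewrite (ltW ab).
exact: (cs 0%N isT).
Qed.

Lemma connected_curve_image (gam : R -> R * R) : pw_C2 gam -> connected (curve_image gam).
Proof.
move=> [s [s_path s_last s_C2]].
have -> : curve_image gam = gam @` `[0, last 0 s]%classic.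
  rewrite /curve_image s_last; suff -> : @unit_interval R = `[0, 1]%classic by [].
  by apply/seteqP; split=> t; rewrite /unit_interval /= in_itv.
apply: connected_chain => // i /s_C2[g1 [g2 [/C2_continuous c1 /C2_continuous c2 gE]]].
rewrite (eq_imagel (f' := fun t => (g1 t, g2 t))).
  apply: connected_continuous_connected; first exact: segment_connected.
  by apply: continuous_subspaceT => t; apply: cvg_pair_nbhs; [exact: c1 | exact: c2].
by move=> t; rewrite /= in_itv => /gE.
Qed.

End Components.

(** * The decomposition *)

Theorem theorem2p3 (R : realType) (f : {poly {poly R}}) :
  irreducible2 f ->
  compact (zero_set f) ->
  connected (zero_set f) ->
  exists A : set (set (R * R)),
    cell_decomposition (zero_set f) A /\ finiteness_property (zero_set f) A.
Proof.
move=> [f_nunit f_irr] cX _.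
(* The factorization [0 = 0 * 0] into nonunits contradicts irreducibility. *)
have f0 : f != 0.
  apply/eqP => f0; have [] := f_irr 0 0; rewrite ?mul0r //; by rewrite unitr0.
have [q [r [r0 fq]]] := squarefree_part f0.
have splits x : ~ root r x -> exists2 d, 0 < d & splits_over (zero_set f) (x - d) (x + d).
  by move=> /negP rx; exact: (splits_over_near cX fq rx).
have [T [cT Tsplit Tdisj cE]] :=
  dyadic_partition (@splits_over_sub R (zero_set f)) splits.
have /boolp.choice[G GP] : forall I, exists H : set (set (R * R)), T I ->
    [/\ countable H, forall e, H e -> graph_cell (zero_set f) I.1 I.2 e,
        forall e1 e2, H e1 -> H e2 -> e1 `&` e2 !=set0 -> e1 = e2 &
        \bigcup_(e in H) e = zero_set f `&` strip I.1 I.2].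
  move=> I; have [TI|nTI] := pselect (T I); last by exists set0.
  by have [_ [H HP]] := Tsplit I TI; exists H.
(* [E] consists of the abscissas that no chosen interval covers: countably many nonroots of [r] and
   finitely many roots. *)
pose E := [set x | forall I, T I -> ~ I.1 < x < I.2].
have cE' : countable E.
  rewrite -(setDUK (_ : E `&` [set x | root r x] `<=` E)); last by move=> x [].
  apply: countableU; last by rewrite setDIr setDv set0U.
  apply/finite_set_countable/(sub_finite_set _ (finite_roots r0)).
  by move=> x [].
(* These points become the 0-cells; they are countable because each fiber is finite. *)
pose Z := [set p | zero_set f p /\ E p.1].
have cZ : countable Z.
  have -> : Z = \bigcup_(x in E) [set p | zero_set f p /\ p.1 = x].
    apply/seteqP; split=> p; first by move=> [fp Ep]; exists p.1.
    by move=> [x Ex [fp px]]; split=> //; rewrite px.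
  apply: bigcup_countable => // x Ex; apply: finite_set_countable.
  have [s sP] := finite_fiber x cX.
  apply: (sub_finite_set _ (finite_image (fun y => (x, y)) (finite_seq s))).
  move=> [x' y] [fp /= xx']; subst x'; exists y => //=; exact/sP.
have cell1 e I : T I -> G I e -> is_1cell e.
  move=> TI Ge; have [_ gG _ _] := GP I TI.
  by apply: is_1cell_graph_cell (gG _ Ge); have [] := Tsplit I TI.
have cell_strip e I p : T I -> G I e -> e p -> zero_set f p /\ strip I.1 I.2 p.
  move=> TI Ge ep; have [_ _ _ UG] := GP I TI.
  have : (\bigcup_(e in G I) e) p by exists e.
  by rewrite UG.
pose A := (\bigcup_(I in T) G I) `|` [set [set p] | p in Z].
exists A; split; first split.
- apply: countableU; last exact: sub_countable (card_image_le _ _) cZ.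
  by apply: bigcup_countable => // I TI; have [] := GP I TI.
- move=> e [[I TI Ge]|[p _ <-]]; last by constructor 1; exists p.
  by constructor 2; exact: cell1 TI Ge.
- move=> e1 e2 [[I TI Ge]|[p [fp Ep] <-]] [[J TJ Ge']|[p' [fp' Ep'] <-]].
  + move=> [p [ep e2p]].
    have IJ : I = J.
      apply: Tdisj => //; exists p.1.
      by have [_ ?] := cell_strip _ _ _ TI Ge ep; have [_ ?] := cell_strip _ _ _ TJ Ge' e2p.
    rewrite -IJ in Ge'; have [_ _ disj _] := GP I TI.
    by apply: disj => //; exists p.
  + move=> [x [ep /= xp]]; rewrite xp in ep; have [_ pI] := cell_strip _ _ _ TI Ge ep.
    by case: (Ep' I TI pI).
  + move=> [x [/= xp ep]]; rewrite xp in ep; have [_ pI] := cell_strip _ _ _ TJ Ge' ep.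
    by case: (Ep J TJ pI).
  + by move=> [x [/= <- <-]].
- apply/seteqP; split=> p.
    move=> [e [[I TI Ge]|[p' [fp _] <-]] ep]; last by rewrite ep.
    by have [] := cell_strip _ _ _ TI Ge ep.
  move=> fp; have [Ep|nEp] := pselect (E p.1).
    by exists [set p] => //; right; exists p.
  have [I [TI pI]] : exists I, T I /\ I.1 < p.1 < I.2.
    by apply: contrapT => h; apply: nEp => I TI pI; apply: h; exists I.
  have [_ _ _ UG] := GP I TI.
  have : (\bigcup_(e in G I) e) p by rewrite UG.
  by move=> [e Ge ep]; exists e => //; left; exists I.
move=> a b gam [gam_C2 [_ _ gamX] _] e Ae /=.
set S := curve_image gam `&` e.
have compS x : S x -> connected_component S x !=set0.
  by move=> Sx; exists x; exact: connected_component_refl.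
have compe x : connected_component S x `<=` e.
  by move=> y /connected_component_sub[].
case: (Ae) => [[I TI Ge]|[p _ pe]].
  have [_ gG _ _] := GP I TI.
  split.
    apply: finite_components (gG _ Ge) _ _; last exact: connected_curve_image.
    by move=> _ [t t01 <-]; exact: gamX.
  move=> x Sx; have [|arcC] := connected_subset_graph (gG _ Ge)
    (@component_connected _ S x) (compS x Sx) (@compe x); first by left.
  (* The component is an arc, and [e] itself serves as the 1-cell whose closure contains it. *)
  right; right; split=> //; exists e; split=> //; first exact: cell1 TI Ge.
  by apply: subset_trans (@compe x) _; exact: subset_closure.
(* Here [e] is a 0-cell, so [S] has at most one point. *)
have SE x : S x -> connected_component S x = [set p].
  move=> Sx; apply/seteqP; split=> [y /compe|_ ->]; first by rewrite -pe.
  have : e x by case: Sx.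
  by rewrite -{1}pe => xp; rewrite -{1}xp; exact: connected_component_refl.
split; last by move=> x Sx; left; exists p; exact: SE.
by apply: finite_image_subsingleton => x y Sx Sy; rewrite !SE.
Qed.
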